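(* Let $\Gamma$ be a finitely generated group which is either amenable or of finite asymptotic dimension. Then $\Gamma$ is weighted hyperfinite, i.e. its Cayley graph with respect to any finite symmetric generating set is weighted hyperfinite.
   Context: A connected infinite graph $G$ with bounded vertex degrees is weighted hyperfinite if for every $\epsilon>0$ there is $K_\epsilon>0$ such that for every finite induced subgraph $L\subseteq G$ and every function $w:V(L)\to[0,\infty)$ there is a set $M\subseteq V(L)$ with $\sum_{x\in M}w(x)\le\epsilon\sum_{x\in V(L)}w(x)$ such that every connected component of the graph obtained from $L$ by deleting $M$ (and incident edges) has at most $K_\epsilon$ vertices. (This property is invariant under quasi-isometry, so it is independent of the generating set.) The Cayley graph of $\Gamma$ w.r.t. a finite symmetric generating set $S$ has vertex set $\Gamma$, with $x,y$ adjacent iff $x=sy$ for some $s\in S$. A graph $G$ has asymptotic dimension at most $d$ if for every $r>0$ there is $R=R(r)$ and vertex-disjoint induced subgraphs $\mathcal U_1,\dots,\mathcal U_d$ covering $V(G)$ such that for each $i$, each connected component of $\mathcal U_i$ has diameter at most $R$ and distinct components of $\mathcal U_i$ are at distance at least $r$ in $G$; a group has finite asymptotic dimension if its Cayley graph does (a quasi-isometry invariant). *)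

(* Defs.v *)
From Stdlib Require Import Reals List.
Import ListNotations.
Open Scope R_scope.

Record Group := {
  carrier :> Type;
  gmul : carrier -> carrier -> carrier;
  ginv : carrier -> carrier;
  gone : carrier;
  gmul_assoc : forall x y z, gmul x (gmul y z) = gmul (gmul x y) z;
  gmul_1l : forall x, gmul gone x = x;
  gmul_Vl : forall x, gmul (ginv x) x = gone
}.

Definition symmetric_set (G : Group) (S : list G) : Prop :=
  forall s, In s S -> In (ginv G s) S.

Inductive generated (G : Group) (S : list G) : G -> Prop :=
| gen_one : generated G S (gone G)
| gen_step : forall s x, In s S -> generated G S x -> generated G S (gmul G s x).

Definition finite_symmetric_generating_set (G : Group) (S : list G) : Prop :=
  symmetric_set G S /\ forall x : G, generated G S x.

Definition finitely_generated (G : Group) : Prop :=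
  exists S : list G, finite_symmetric_generating_set G S.

Definition cayley_adj (G : Group) (S : list G) (x y : G) : Prop :=
  exists s, In s S /\ x = gmul G s y.

Section Graphs.
Context {V : Type} (adj : V -> V -> Prop).

Inductive conn_in (P : V -> Prop) : V -> V -> Prop :=
| conn_refl : forall x, P x -> conn_in P x x
| conn_step : forall x y z, conn_in P x y -> P z -> adj y z -> conn_in P x z.

Inductive walk : nat -> V -> V -> Prop :=
| walk0 : forall x, walk 0 x x
| walkS : forall n x y z, walk n x y -> adj y z -> walk (S n) x z.

Definition dist_le (n : nat) (x y : V) : Prop := exists k, (k <= n)%nat /\ walk k x y.
Definition dist_lt (n : nat) (x y : V) : Prop := exists k, (k < n)%nat /\ walk k x y.

Definition wsum (w : V -> R) (l : list V) : R := fold_right (fun x acc => w x + acc) 0 l.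

Definition components_bounded (P : V -> Prop) (K : nat) : Prop :=
  forall x (c : list V), P x -> NoDup c -> (forall y, In y c -> conn_in P x y) ->
    (length c <= K)%nat.

Definition weighted_hyperfinite : Prop :=
  forall eps : R, 0 < eps -> exists K : nat, (0 < K)%nat /\
    forall (L : list V) (w : V -> R), NoDup L -> (forall x, In x L -> 0 <= w x) ->
      exists M : list V, NoDup M /\ incl M L /\
        wsum w M <= eps * wsum w L /\
        components_bounded (fun x => In x L /\ ~ In x M) K.

(** asymptotic dimension at most d (as in the paper: d families U_1..U_d) *)
Definition asdim_le (d : nat) : Prop :=
  forall r : nat, (0 < r)%nat -> exists Rr : nat, exists U : nat -> V -> Prop,
    (forall x, exists i, (i < d)%nat /\ U i x) /\
    (forall i j x, (i < d)%nat -> (j < d)%nat -> U i x -> U j x -> i = j) /\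
    (forall i, (i < d)%nat ->
       (forall x y, conn_in (U i) x y -> dist_le Rr x y) /\
       (forall x y, U i x -> U i y -> ~ conn_in (U i) x y -> ~ dist_lt r x y)).

End Graphs.

Definition finite_asdim (G : Group) : Prop :=
  exists S : list G, finite_symmetric_generating_set G S /\
    exists d : nat, asdim_le (cayley_adj G S) d.

Definition amenable (G : Group) : Prop :=
  exists m : (G -> Prop) -> R,
    (forall A, 0 <= m A) /\
    m (fun _ => True) = 1 /\
    (forall A B, (forall x, A x -> B x -> False) ->
        m (fun x => A x \/ B x) = m A + m B) /\
    (forall (g : G) A, m (fun x => A (gmul G (ginv G g) x)) = m A).

(* Main.v *)
Require Import Defs.
From Stdlib Require Import Reals List.
From Stdlib Require Import Lra Lia Wf_nat Classical ClassicalEpsilon.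
From Stdlib Require Import FunctionalExtensionality PropExtensionality.
Import ListNotations.

(** Both hypotheses give a weighted isoperimetric inequality: every weighted finite subgraph has a
    piece [E] with components of bounded size whose vertex boundary weighs at most [eps] times [E].
    Deleting the boundary and repeating outside of [E] produces the separator, since the successive
    pieces are disjoint.

    If the group is amenable, it has Folner sets [F] (otherwise Hall's theorem yields a paradoxical
    decomposition, which contradicts the invariant mean). Right translations are automorphisms
    of the Cayley graph, and averaging the weight over all translates of [F] shows that
    some translate is a suitable piece.

    If the asymptotic dimension is finite, take the colour class carrying a [1/d] fraction of the
    weight. Among its nested neighbourhoods of radius [0, ..., n], where [(1 + eps)^n >= d], two
    consecutive ones differ in weight by a factor at most [1 + eps], and the components of these
    neighbourhoods are bounded because the components of the class are far apart. *)

(** * Classical decisions and filtering by arbitrary predicates *)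

Definition decide (P : Prop) : bool :=
  if excluded_middle_informative P then true else false.

Lemma decideP (P : Prop) : decide P = true <-> P.
Proof.
  unfold decide; destruct (excluded_middle_informative P); split; intros; auto; discriminate.
Qed.

Lemma classical_eq_dec (T : Type) (x y : T) : {x = y} + {x <> y}.
Proof. exact (excluded_middle_informative (x = y)). Qed.

Definition sieve {T} (P : T -> Prop) (l : list T) : list T :=
  filter (fun x => decide (P x)) l.

Lemma in_sieve {T} (P : T -> Prop) l x : In x (sieve P l) <-> In x l /\ P x.
Proof. unfold sieve; rewrite filter_In, decideP; tauto. Qed.

Lemma NoDup_sieve {T} (P : T -> Prop) l : NoDup l -> NoDup (sieve P l).
Proof. apply NoDup_filter. Qed.

Lemma length_sieve_lt {T} (P : T -> Prop) l x :
  In x l -> ~ P x -> (length (sieve P l) < length l)%nat.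
Proof.
  intros Hx HP. unfold sieve.
  induction l as [|a l IH]; [easy|]. simpl.
  pose proof (filter_length_le (fun x => decide (P x)) l).
  destruct (decide (P a)) eqn:E; simpl.
  - destruct Hx as [<-|Hx]; [rewrite decideP in E; contradiction|]. specialize (IH Hx); lia.
  - lia.
Qed.

(** * Weighted sums over finite lists *)

Section Weights.
Context {V : Type}.
Implicit Types (w : V -> R) (l : list V) (P Q : V -> Prop).

Lemma wsum_app w l l' : wsum w (l ++ l') = wsum w l + wsum w l'.
Proof. induction l; simpl; [lra|]. rewrite IHl; lra. Qed.

Lemma wsum_ge0 w l : (forall x, In x l -> 0 <= w x) -> 0 <= wsum w l.
Proof.
  induction l; simpl; intros H; [lra|].
  pose proof (H a (or_introl eq_refl)). specialize (IHl (fun x h => H x (or_intror h))). lra.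
Qed.

Lemma wsum_le w w' l : (forall x, In x l -> w x <= w' x) -> wsum w l <= wsum w' l.
Proof.
  induction l; simpl; intros H; [lra|].
  pose proof (H a (or_introl eq_refl)). specialize (IHl (fun x h => H x (or_intror h))). lra.
Qed.

Lemma wsum_ext w w' l : (forall x, In x l -> w x = w' x) -> wsum w l = wsum w' l.
Proof. intros H. apply Rle_antisym; apply wsum_le; intros x Hx; rewrite H; auto; lra. Qed.

Lemma wsum_scal c w l : wsum (fun x => c * w x) l = c * wsum w l.
Proof. induction l; simpl; [lra|]. rewrite IHl; lra. Qed.

Lemma wsum_add w w' l : wsum (fun x => w x + w' x) l = wsum w l + wsum w' l.
Proof. induction l; simpl; [lra|]. rewrite IHl; lra. Qed.

Lemma wsum_pos_ex w l : 0 < wsum w l -> exists x, In x l /\ 0 < w x.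
Proof.
  intros H. apply NNPP; intros N.
  assert (wsum w l <= wsum (fun _ => 0 * 0) l).
  { apply wsum_le; intros x Hx. destruct (Rle_lt_dec (w x) 0); [lra|].
    exfalso; eauto. }
  rewrite wsum_scal in H0. lra.
Qed.

Lemma wsum_sieve_split P w l :
  wsum w l = wsum w (sieve P l) + wsum w (sieve (fun x => ~ P x) l).
Proof.
  unfold sieve; induction l; simpl; [lra|].
  destruct (decide (P a)) eqn:E1, (decide (~ P a)) eqn:E2; simpl; rewrite ?IHl; try lra.
  - rewrite decideP in E1, E2; tauto.
  - exfalso. rewrite <- Bool.not_true_iff_false, decideP in E1, E2. tauto.
Qed.

Definition indicator (P : V -> Prop) (x : V) : R := if decide (P x) then 1 else 0.

Lemma wsum_sieve P w l : wsum w (sieve P l) = wsum (fun x => w x * indicator P x) l.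
Proof.
  unfold sieve, indicator; induction l; simpl; [lra|].
  destruct (decide (P a)); simpl; rewrite IHl; lra.
Qed.

Lemma wsum_indicator P l : wsum (indicator P) l = INR (length (sieve P l)).
Proof.
  unfold sieve, indicator; induction l; [easy|].
  cbn [wsum fold_right filter] in *. fold (wsum (fun x => if decide (P x) then 1 else 0) l) in *.
  destruct (decide (P a)); cbn [length]; rewrite ?S_INR, IHl; lra.
Qed.

Lemma sieve_ext P Q l : (forall x, In x l -> P x <-> Q x) -> sieve P l = sieve Q l.
Proof.
  intros H. apply filter_ext_in. intros x Hx. specialize (H x Hx).
  apply Bool.eq_true_iff_eq. rewrite !decideP. exact H.
Qed.

Lemma sieve_sieve P Q l : sieve P (sieve Q l) = sieve (fun x => Q x /\ P x) l.
Proof.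
  unfold sieve. induction l as [|a l IH]; [easy|]. simpl.
  assert (E : decide (Q a /\ P a) = andb (decide (Q a)) (decide (P a))).
  { apply Bool.eq_true_iff_eq. rewrite Bool.andb_true_iff, !decideP. tauto. }
  rewrite E. destruct (decide (Q a)); simpl; [destruct (decide (P a))|]; now rewrite ?IH.
Qed.

Lemma wsum_sieve_mono P Q w l :
  (forall x, In x l -> 0 <= w x) -> (forall x, In x l -> P x -> Q x) ->
  wsum w (sieve P l) <= wsum w (sieve Q l).
Proof.
  intros Hw H. rewrite !wsum_sieve. apply wsum_le. intros x Hx. unfold indicator.
  specialize (Hw x Hx). specialize (H x Hx).
  destruct (decide (P x)) eqn:E1, (decide (Q x)) eqn:E2; try lra.
  rewrite decideP in E1. apply H in E1. rewrite <- decideP in E1. congruence.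
Qed.

End Weights.

Lemma wsum_swap {V W : Type} (a : V -> W -> R) (l : list V) (l' : list W) :
  wsum (fun x => wsum (a x) l') l = wsum (fun y => wsum (fun x => a x y) l) l'.
Proof.
  induction l; simpl.
  - induction l'; simpl; lra.
  - rewrite IHl, <- wsum_add. reflexivity.
Qed.

(** * From weighted isoperimetry to hyperfiniteness *)

Section Exhaustion.
Context {V : Type} (adj : V -> V -> Prop).
Hypothesis adj_sym : forall x y, adj x y -> adj y x.

(* Uniform local amenability in the presence of weights; [E'] contains [E] and its boundary. *)
Definition weighted_isoperimetric (eps : R) (K : nat) : Prop :=
  forall (L : list V) (w : V -> R), NoDup L -> (forall x, In x L -> 0 <= w x) ->
    0 < wsum w L ->
    exists E E' : V -> Prop,
      (forall x, E x -> E' x) /\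
      (forall x y, E x -> adj x y -> E' y) /\
      components_bounded adj (fun x => In x L /\ E x) K /\
      wsum w (sieve E' L) <= (1 + eps) * wsum w (sieve E L) /\
      0 < wsum w (sieve E L).

Lemma conn_in_right P x y : conn_in adj P x y -> P y.
Proof. now destruct 1. Qed.

(** A path in [P] cannot leave a set [Q] that is closed under the steps into [P]. This confines a
    component to one side of a deleted shell. *)
Lemma conn_in_invariant (P Q : V -> Prop) :
  (forall y z, Q y -> P z -> adj y z -> Q z) ->
  forall x y, conn_in adj P x y -> Q x -> conn_in adj Q x y.
Proof.
  intros H x y C Qx. induction C as [x Px | x y z C IH Pz A].
  - now constructor.
  - specialize (IH Qx). apply conn_step with y; auto. apply H with y; auto. now apply conn_in_right in IH.
Qed.

(* Greedy exhaustion: delete the shell [E' \ E], which isolates [E], and continue outside [E'];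
   the shells cost [eps] times the weight of disjoint pieces. *)
Lemma isoperimetric_separator eps K : 0 < eps -> weighted_isoperimetric eps K ->
  forall (L : list V) (w : V -> R), NoDup L -> (forall x, In x L -> 0 <= w x) ->
    exists M : list V, NoDup M /\ incl M L /\ wsum w M <= eps * wsum w L /\
      components_bounded adj (fun x => In x L /\ ~ In x M) K.
Proof.
  intros Heps HI L w.
  induction L as [L IH] using (induction_ltof1 _ (@length V)).
  unfold ltof in IH. intros ND Hw.
  destruct (Rle_lt_dec (wsum w L) 0) as [H0|H0].
  (* Without positive weight, deleting everything costs nothing. *)
  { exists L. repeat split; auto using incl_refl.
    - pose proof (wsum_ge0 w L Hw). nra.
    - intros x c [H1 H2]; tauto. }
  destruct (HI L w ND Hw H0) as (E & E' & HE & HN & HB & HW & HP).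
  set (D := sieve (fun x => E' x /\ ~ E x) L).
  set (L' := sieve (fun x => ~ E' x) L).
  (* The recursion terminates because [E] has positive weight in [L] and hence meets it. *)
  assert (HL' : (length L' < length L)%nat).
  { destruct (wsum_pos_ex _ _ HP) as (x & Hx & _). apply in_sieve in Hx.
    apply length_sieve_lt with x; [tauto|]. intros n; apply n, HE; tauto. }
  destruct (IH L' HL') as (M & NDM & IM & WM & BM).
  { now apply NoDup_sieve. }
  { intros x Hx. apply in_sieve in Hx. apply Hw; tauto. }
  assert (inD : forall x, In x D <-> In x L /\ E' x /\ ~ E x) by (intro; exact (in_sieve _ L x)).
  assert (inL' : forall x, In x L' <-> In x L /\ ~ E' x) by (intro; exact (in_sieve _ L x)).
  exists (D ++ M). repeat split.
  - apply NoDup_app; auto.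
    + now apply NoDup_sieve.
    + intros x HD HM. apply IM, inL' in HM. apply inD in HD. tauto.
  - apply incl_app; intros x Hx; [apply inD in Hx | apply IM, inL' in Hx]; tauto.
  - rewrite wsum_app.
    (* [L] splits into [E], the shell [D] and [L']. The shell weighs at most [eps] times [E], and
       [M] at most [eps] times [L']. *)
    pose proof (wsum_sieve_split E' w L) as A1. fold L' in A1.
    pose proof (wsum_sieve_split E w (sieve E' L)) as A2.
    rewrite !sieve_sieve in A2. fold D in A2.
    rewrite (sieve_ext (fun x => E' x /\ E x) E) in A2 by (intros; specialize (HE x); tauto).
    assert (0 <= wsum w D).
    { apply wsum_ge0. intros x Hx. apply inD in Hx. apply Hw; tauto. }
    nra.
  - intros x c [Lx Mx] NDc Hc. rewrite in_app_iff, inD in Mx.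
    (* With the shell gone, a component lies either inside [E] or inside [L']. *)
    destruct (classic (E x)) as [Ex|Ex].
    + apply (HB x); auto. intros y Hy.
      apply (conn_in_invariant (fun x => In x L /\ ~ In x (D ++ M))); auto.
      intros a b [La Ea] [Lb Mb] Aab. rewrite in_app_iff, inD in Mb.
      specialize (HN _ _ Ea Aab). split; auto. apply NNPP. tauto.
    + apply (BM x); [rewrite inL'; tauto | auto |]. intros y Hy.
      apply (conn_in_invariant (fun x => In x L /\ ~ In x (D ++ M))); auto.
      * intros a b [La Ma] [Lb Mb] Aab. rewrite in_app_iff, inD in Mb.
        apply inL' in La. apply adj_sym in Aab.
        assert (~ E b) by (intros Eb; apply La, (HN b); auto).
        rewrite inL'. tauto.
      * rewrite inL'; tauto.
Qed.

Lemma components_bounded_mono P K K' :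
  (K <= K')%nat -> components_bounded adj P K -> components_bounded adj P K'.
Proof. intros HK H x c Px ND Hc. specialize (H x c Px ND Hc). lia. Qed.

Lemma isoperimetric_weighted_hyperfinite :
  (forall eps, 0 < eps -> exists K, weighted_isoperimetric eps K) ->
  weighted_hyperfinite adj.
Proof.
  intros H eps Heps. destruct (H eps Heps) as [K HK].
  (* The successor meets the demand for a positive bound. *)
  exists (S K). split; [lia|]. intros L w ND Hw.
  destruct (isoperimetric_separator eps K Heps HK L w ND Hw) as (M & H1 & H2 & H3 & H4).
  exists M. repeat split; auto. apply components_bounded_mono with K; auto.
Qed.

Lemma walk_cat m n x y z : walk adj m x y -> walk adj n y z -> walk adj (m + n) x z.
Proof.
  intros H1 H2. revert H1. induction H2; intros.
  - now rewrite Nat.add_0_r.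
  - rewrite Nat.add_succ_r. econstructor; eauto.
Qed.

Lemma walk_rev n x y : walk adj n x y -> walk adj n y x.
Proof.
  induction 1 as [|n x y z W IH A]; [constructor|].
  apply (walk_cat 1 n z y x); auto. repeat econstructor; auto.
Qed.

Lemma conn_in_trans P x y z :
  conn_in adj P x y -> conn_in adj P y z -> conn_in adj P x z.
Proof. intros H1 H2. induction H2; eauto using @conn_step. Qed.

End Exhaustion.

(** Bernoulli's inequality, with [n] above [b / eps]. *)
Lemma pow_unbounded eps b : 0 < eps -> exists n, b <= (1 + eps) ^ n.
Proof.
  intros He. destruct (INR_unbounded (b / eps)) as [n Hn].
  exists n. pose proof (poly n eps He).
  apply Rmult_gt_compat_r with (r := eps) in Hn; auto.
  unfold Rdiv in Hn. rewrite Rmult_assoc, Rinv_l, Rmult_1_r in Hn; lra.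
Qed.

(** * Counting list elements without multiplicity *)

Definition card {T} (l : list T) : nat := length (nodup (classical_eq_dec T) l).

Lemma card_le {T} (l l' : list T) : incl l l' -> (card l <= card l')%nat.
Proof.
  intros H. apply NoDup_incl_length; [apply NoDup_nodup|].
  intros x. rewrite !nodup_In. apply H.
Qed.

Lemma card_NoDup {T} (l : list T) : NoDup l -> card l = length l.
Proof. intros H. unfold card. now rewrite nodup_fixed_point. Qed.

Lemma card_le_length {T} (l : list T) : (card l <= length l)%nat.
Proof. apply NoDup_incl_length; [apply NoDup_nodup|]. intros x; now rewrite nodup_In. Qed.

Lemma card_nodup {T} (l : list T) : card (nodup (classical_eq_dec T) l) = card l.
Proof. apply card_NoDup, NoDup_nodup. Qed.

(** Inclusion-exclusion, with [++] as union and [sieve] as intersection; this is the modularity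
    behind Rado's argument. *)
Lemma card_union_inter {T} (l l' : list T) :
  (card (l ++ l') + card (sieve (fun x => In x l') l) = card l + card l')%nat.
Proof.
  set (m := nodup (classical_eq_dec T) l).
  assert (Hm : forall x, In x m <-> In x l) by (intro; apply nodup_In).
  assert (Nm : NoDup m) by apply NoDup_nodup.
  assert (Hi : card (sieve (fun x => In x l') l) = length (sieve (fun x => In x l') m)).
  { rewrite <- card_NoDup by now apply NoDup_sieve.
    apply Nat.le_antisymm; apply card_le; intros x; rewrite !in_sieve, Hm; auto. }
  assert (Hu : card (l ++ l') =
               (length (sieve (fun x => ~ In x l') m) + card l')%nat).
  { change (card l') with (length (nodup (classical_eq_dec T) l')).
    rewrite <- length_app, <- card_NoDup.
    - apply Nat.le_antisymm; apply card_le; intros x;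
        rewrite !in_app_iff, in_sieve, nodup_In, Hm; tauto.
    - apply NoDup_app; [now apply NoDup_sieve | apply NoDup_nodup |].
      intros x. rewrite in_sieve, nodup_In. tauto. }
  assert (Hs : length m = (length (sieve (fun x => In x l') m)
                           + length (sieve (fun x => ~ In x l') m))%nat).
  (* The indicators of a predicate and of its negation add up to 1 at every element. *)
  { rewrite Nat.add_comm. apply INR_eq. rewrite plus_INR, <- !wsum_indicator, <- wsum_add.
    clear. induction m as [|a m IH]; [easy|]. cbn [length wsum fold_right].
    rewrite S_INR, IH. unfold wsum, indicator.
    destruct (decide (In a l')) eqn:E1, (decide (~ In a l')) eqn:E2;
      rewrite <- ?Bool.not_true_iff_false, ?decideP in *; try tauto; lra. }
  rewrite Hi, Hu. fold m in Hs. unfold card at 2. fold m. lia.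
Qed.

(** * Hall's marriage theorem with finite neighbourhoods *)

Section Hall.
Context {X Y : Type}.
Implicit Types (N : X -> list Y) (A : list X).

Definition hall N : Prop :=
  forall A, NoDup A -> (length A <= card (flat_map N A))%nat.

Definition subrel N N' : Prop := forall x, incl (N x) (N' x).

Definition functional_at N x : Prop :=
  forall y y', In y (N x) -> In y' (N x) -> y = y'.

Definition update N x l : X -> list Y :=
  fun x' => if decide (x' = x) then l else N x'.

Lemma update_same N x l : update N x l x = l.
Proof.
  unfold update. destruct (decide (x = x)) eqn:E; auto.
  rewrite <- Bool.not_true_iff_false, decideP in E. tauto.
Qed.

Lemma update_other N x l x' : x' <> x -> update N x l x' = N x'.
Proof.
  intros H. unfold update. destruct (decide (x' = x)) eqn:E; auto.
  rewrite decideP in E. tauto.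
Qed.

Lemma flat_map_update N x l A : ~ In x A -> flat_map (update N x l) A = flat_map N A.
Proof.
  induction A as [|a A IH]; intros H; [easy|]. simpl in *.
  rewrite update_other, IH; auto.
Qed.

(** A set violating the new condition must contain [x], as all other sets keep their neighbours.
    Taking [x] out lowers its size by one, which turns the strict inequality into a weak one. *)
Lemma not_hall_update N x l : hall N -> ~ hall (update N x l) ->
  exists A, NoDup A /\ ~ In x A /\ (card (l ++ flat_map N A) <= length A)%nat.
Proof.
  intros HN H. apply not_all_ex_not in H as [A H]. apply imply_to_and in H as [ND H].
  assert (Hx : In x A).
  { apply NNPP. intros Hx. apply H. rewrite flat_map_update; auto. }
  apply in_split in Hx as (A1 & A2 & ->).
  exists (A1 ++ A2). pose proof (NoDup_remove_1 _ _ _ ND). pose proof (NoDup_remove_2 _ _ _ ND).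
  repeat split; auto.
  rewrite length_app in *. simpl in H.
  assert (card (l ++ flat_map N (A1 ++ A2)) <= card (flat_map (update N x l) (A1 ++ x :: A2)))%nat; [|lia].
  apply card_le. rewrite !flat_map_app. simpl. rewrite in_app_iff in H1.
  rewrite !flat_map_update, update_same by tauto.
  intros y. rewrite !in_app_iff. tauto.
Qed.

(* Rado's argument: if neither [y1] nor [y2] can be dropped from [N x], submodularity of the
   neighbourhood cardinality applied to the two obstructions contradicts Hall's condition. *)
Lemma hall_remove N x y1 y2 : hall N -> y1 <> y2 ->
  hall (update N x (remove (classical_eq_dec Y) y1 (N x))) \/
  hall (update N x (remove (classical_eq_dec Y) y2 (N x))).
Proof.
  intros HN Hy. apply NNPP. intros H. apply not_or_and in H as [H1 H2].
  apply not_hall_update in H1 as (A1 & ND1 & x1 & C1); auto.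
  apply not_hall_update in H2 as (A2 & ND2 & x2 & C2); auto.
  set (X1 := remove (classical_eq_dec Y) y1 (N x) ++ flat_map N A1) in *.
  set (X2 := remove (classical_eq_dec Y) y2 (N x) ++ flat_map N A2) in *.
  set (U := nodup (classical_eq_dec X) (A1 ++ A2)).
  set (I := sieve (fun a => In a A2) A1).
  (* Since [y1] and [y2] differ, [X1] and [X2] together contain all of [N x], so Hall's condition
     applies to [x :: U]; the extra vertex [x] gives the contradiction. *)
  assert (HU : (S (length U) <= card (X1 ++ X2))%nat).
  { assert (ND : NoDup (x :: U)).
    { constructor; [|apply NoDup_nodup]. unfold U. rewrite nodup_In, in_app_iff. tauto. }
    specialize (HN _ ND). simpl in HN. eapply Nat.le_trans; [exact HN|].
    apply card_le. intros y. simpl. unfold X1, X2. rewrite !in_app_iff, !in_flat_map.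
    intros [Hxy|(a & Ha & Hay)].
    - destruct (classical_eq_dec Y y y1) as [->|].
      + right; left. now apply in_in_remove.
      + left; left. now apply in_in_remove.
    - unfold U in Ha. rewrite nodup_In, in_app_iff in Ha. destruct Ha; eauto 6. }
  (* Every neighbour of a common vertex of [A1] and [A2] lies in both [X1] and [X2]. *)
  assert (HI : (length I <= card (sieve (fun y => In y X2) X1))%nat).
  { eapply Nat.le_trans; [apply HN; now apply NoDup_sieve|]. apply card_le.
    intros y. rewrite in_flat_map. intros (a & Ha & Hay). unfold I in Ha.
    apply in_sieve in Ha as [Ha1 Ha2]. rewrite in_sieve. unfold X1, X2.
    rewrite !in_app_iff, !in_flat_map. split; right; eauto. }
  pose proof (card_union_inter X1 X2). pose proof (card_union_inter A1 A2) as HA.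
  fold I in HA. unfold card at 1 in HA. fold U in HA.
  rewrite !card_NoDup in HA; auto. 2: now apply NoDup_sieve.
  lia.
Qed.

Lemma hall_refine_point N x : hall N ->
  exists N', hall N' /\ subrel N' N /\ functional_at N' x.
Proof.
  remember (length (N x)) as k eqn:Ek. revert N Ek.
  induction k as [k IH] using lt_wf_ind. intros N -> HN.
  destruct (classic (functional_at N x)) as [F|F].
  { exists N. repeat split; auto. intros z; apply incl_refl. }
  assert (E : exists y1 y2, In y1 (N x) /\ In y2 (N x) /\ y1 <> y2).
  { apply NNPP. intros E. apply F. intros y y' H H'. apply NNPP. intros n. apply E; eauto. }
  destruct E as (y1 & y2 & Hy1 & Hy2 & Hy).
  assert (Step : forall y, In y (N x) -> hall (update N x (remove (classical_eq_dec Y) y (N x))) ->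
    exists N', hall N' /\ subrel N' N /\ functional_at N' x).
  { intros y Hin H. set (N1 := update N x _) in H.
    assert (N1x : N1 x = remove (classical_eq_dec Y) y (N x)) by apply update_same.
    destruct (IH (length (N1 x))) with (N := N1) as (N' & H' & S' & F'); auto.
    { rewrite N1x. now apply remove_length_lt. }
    exists N'. repeat split; auto. intros z u Hu. apply S' in Hu.
    destruct (classical_eq_dec X z x) as [->|n].
    - rewrite N1x in Hu. now apply in_remove in Hu.
    - unfold N1 in Hu. now rewrite update_other in Hu. }
  destruct (hall_remove N x y1 y2 HN Hy); eauto.
Qed.

Lemma hall_refine N l : hall N ->
  exists N', hall N' /\ subrel N' N /\ forall x, In x l -> functional_at N' x.
Proof.
  intros HN. induction l as [|a l (N1 & H1 & S1 & F1)].
  - exists N. repeat split; auto. intros z; apply incl_refl. easy.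
  - destruct (hall_refine_point N1 a H1) as (N2 & H2 & S2 & F2).
    exists N2. repeat split; auto.
    + intros z y Hy. now apply S1, S2.
    + intros x [<-|Hx]; auto. intros y y' Hy Hy'. apply (F1 x); auto; now apply S2.
Qed.

Lemma hall_nonempty N x : hall N -> exists y, In y (N x).
Proof.
  intros HN. specialize (HN [x]). simpl in HN. rewrite app_nil_r in HN.
  destruct (N x) as [|y l]; [|exists y; now left].
  exfalso. unfold card in HN. simpl in HN.
  assert (1 <= 0)%nat; [|lia]. apply HN. repeat constructor; auto.
Qed.

(* Hall's theorem for a countable left side, exhausted by the finite sets [l n]. *)
Lemma hall_matching N (l : nat -> list X) : hall N -> (forall x, exists n, In x (l n)) ->
  exists f : X -> Y, (forall x, In (f x) (N x)) /\ (forall x x', f x = f x' -> x = x').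
Proof.
  intros HN Hl.
  (* Dependent choice: stage [S n] refines stage [n] and leaves the vertices of [l n] at most one
     neighbour. *)
  set (next := fun n (M : {N | hall N}) =>
     constructive_indefinite_description _ (hall_refine (proj1_sig M) (l n) (proj2_sig M))).
  set (M := fix M n : {N | hall N} := match n with
     | O => exist _ N HN
     | S n => exist _ (proj1_sig (next n (M n))) (proj1 (proj2_sig (next n (M n))))
     end).
  set (R n := proj1_sig (M n)).
  assert (RH : forall n, hall (R n)) by (intro n; exact (proj2_sig (M n))).
  assert (RS : forall n, subrel (R (S n)) (R n)).
  { intro n. exact (proj1 (proj2 (proj2_sig (next n (M n))))). }
  assert (RF : forall n x, In x (l n) -> functional_at (R (S n)) x).
  { intro n. exact (proj2 (proj2 (proj2_sig (next n (M n))))). }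
  assert (RM : forall m n, (m <= n)%nat -> subrel (R n) (R m)).
  { intros m n H. induction H; intros x; [apply incl_refl|].
    eapply incl_tran; [apply RS | apply IHle]. }
  (* Neighbourhoods decrease and are never empty, so once [x] has a single neighbour, that neighbour
     persists through all stages. *)
  assert (E : forall x, exists y, forall n, In y (R n x)).
  { intros x. destruct (Hl x) as [m Hm]. apply RF in Hm.
    destruct (hall_nonempty (R (S m)) x (RH _)) as [y Hy]. exists y. intros n.
    destruct (Nat.le_gt_cases (S m) n) as [H|H].
    - destruct (hall_nonempty (R n) x (RH _)) as [y' Hy'].
      rewrite (Hm y y'); auto. now apply (RM (S m) n H).
    - apply (RM n (S m)); auto. lia. }
  apply choice in E as [f Hf]. exists f. split.
  { intros x. exact (Hf x 0%nat). }
  intros x x' Hx. apply NNPP. intros n.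
  destruct (Hl x) as [m Hm], (Hl x') as [m' Hm'].
  apply RF in Hm, Hm'. set (p := S (m + m')).
  (* At stage [p] both vertices have only the value [f x] left, so Hall's condition fails for the
     pair. *)
  assert (H : (length [x; x'] <= card (flat_map (R p) [x; x']))%nat).
  { apply RH. repeat constructor; simpl; intuition. }
  assert (H' : (card (flat_map (R p) [x; x']) <= card [f x])%nat).
  { apply card_le. intros y. simpl. rewrite !in_app_iff. intros [Hy|[Hy|[]]]; left.
    - apply Hm; auto. apply (RM (S m) p); auto. unfold p; lia.
    - rewrite Hx. apply Hm'; auto. apply (RM (S m') p); auto. unfold p; lia. }
  pose proof (card_le_length [f x]). simpl in *. lia.
Qed.

End Hall.

(** * Group identities, neighbourhoods and balls in the Cayley graph *)

Section Groups.
Context (G : Group).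
Local Notation "x ** y" := (gmul G x y) (at level 40, left associativity).
Local Notation "x ^-" := (ginv G x) (at level 3).

Lemma gmul_Vr x : x ** x^- = gone G.
Proof.
  rewrite <- (gmul_1l G (x ** x^-)), <- (gmul_Vl G (x^-)) at 1.
  rewrite <- gmul_assoc, (gmul_assoc G (x^-) x), gmul_Vl, gmul_1l. apply gmul_Vl.
Qed.

Lemma gmul_1r x : x ** gone G = x.
Proof. now rewrite <- (gmul_Vl G x), gmul_assoc, gmul_Vr, gmul_1l. Qed.

Lemma gmul_VK x y : x^- ** (x ** y) = y.
Proof. now rewrite gmul_assoc, gmul_Vl, gmul_1l. Qed.

Lemma gmul_KV x y : x ** (x^- ** y) = y.
Proof. now rewrite gmul_assoc, gmul_Vr, gmul_1l. Qed.

Lemma gmul_rK x y : x ** y ** y^- = x.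
Proof. now rewrite <- gmul_assoc, gmul_Vr, gmul_1r. Qed.

Lemma gmul_rVK x y : x ** y^- ** y = x.
Proof. now rewrite <- gmul_assoc, gmul_Vl, gmul_1r. Qed.


Lemma ginv_inv x : x^-^- = x.
Proof. now rewrite <- (gmul_1r (x^-^-)), <- (gmul_Vl G x), gmul_VK. Qed.

Lemma ginv_inj x y : x^- = y^- -> x = y.
Proof. intros H. now rewrite <- (ginv_inv x), H, ginv_inv. Qed.

Lemma ginv_mul x y : (x ** y)^- = y^- ** x^-.
Proof.
  rewrite <- (gmul_VK (x ** y) (y^- ** x^-)).
  now rewrite (gmul_assoc G (x ** y)), gmul_rK, gmul_Vr, gmul_1r.
Qed.

Lemma cayley_adj_sym S : symmetric_set G S ->
  forall x y, cayley_adj G S x y -> cayley_adj G S y x.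
Proof.
  intros HS x y (s & Hs & ->). exists (s^-). split; auto. now rewrite gmul_VK.
Qed.

(** The closed 1-neighbourhood of [F]. The list may repeat elements, so its size is measured by
    [card]. *)
Definition fatten (S F : list G) : list G :=
  F ++ flat_map (fun x => map (fun s => s ** x) S) F.

Lemma in_fatten S F y :
  In y (fatten S F) <-> In y F \/ exists x s, In x F /\ In s S /\ y = s ** x.
Proof.
  unfold fatten. rewrite in_app_iff, in_flat_map. setoid_rewrite in_map_iff. firstorder.
Qed.

(** Edges are left multiplications, which commute with right translations. *)
Lemma fatten_translate S F h :
  fatten S (map (fun x => x ** h) F) = map (fun x => x ** h) (fatten S F).
Proof.
  unfold fatten. rewrite map_app. f_equal. induction F as [|a F IH]; [easy|].
  simpl. rewrite map_app, map_map. f_equal; auto. apply map_ext. intros; apply gmul_assoc.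
Qed.

Definition ball (S : list G) (n : nat) : list G := Nat.iter n (fatten S) [gone G].

Lemma iter_fatten_translate S n F h :
  Nat.iter n (fatten S) (map (fun x => x ** h) F) =
  map (fun x => x ** h) (Nat.iter n (fatten S) F).
Proof. induction n; simpl; [easy|]. now rewrite IHn, fatten_translate. Qed.

Lemma ball_translate S n h :
  map (fun x => x ** h) (ball S n) = Nat.iter n (fatten S) [h].
Proof.
  unfold ball. rewrite <- iter_fatten_translate. simpl. now rewrite gmul_1l.
Qed.

Lemma walk_ball S : symmetric_set G S -> forall n x y,
  walk (cayley_adj G S) n x y -> In y (map (fun t => t ** x) (ball S n)).
Proof.
  intros HS n x y W. rewrite ball_translate. induction W as [|n x y z W IH A]; simpl; auto.
  apply in_fatten. right. apply cayley_adj_sym in A; auto. destruct A as (s & Hs & ->). eauto.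
Qed.

Lemma ball_incl S m n : (m <= n)%nat -> incl (ball S m) (ball S n).
Proof.
  induction 1; [apply incl_refl|]. intros x Hx. apply in_fatten. left. now apply IHle.
Qed.

Lemma dist_le_ball S : symmetric_set G S -> forall n x y,
  dist_le (cayley_adj G S) n x y -> In y (map (fun t => t ** x) (ball S n)).
Proof.
  intros HS n x y (k & Hk & W). apply walk_ball in W; auto.
  revert W. apply incl_map. now apply ball_incl.
Qed.

Lemma generated_ball S x : generated G S x -> exists n, In x (ball S n).
Proof.
  induction 1 as [|s x Hs _ [n IH]]; [now exists 0%nat; left|].
  exists (Datatypes.S n). apply in_fatten. right; eauto.
Qed.

End Groups.

(** * Invariant means, Folner sets and isoperimetry for amenable groups *)

Section Amenable.
Context (G : Group).
Local Notation "x ** y" := (gmul G x y) (at level 40, left associativity).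
Local Notation "x ^-" := (ginv G x) (at level 3).

Section Mean.
Context (m : (G -> Prop) -> R).
Hypothesis m_ge0 : forall A, 0 <= m A.
Hypothesis m_add : forall A B, (forall x, A x -> B x -> False) ->
  m (fun x => A x \/ B x) = m A + m B.
Hypothesis m_inv : forall (g : G) A, m (fun x => A (g^- ** x)) = m A.

Lemma mean_ext (A B : G -> Prop) : (forall x, A x <-> B x) -> m A = m B.
Proof.
  intros H. f_equal. apply functional_extensionality; intros x.
  apply propositional_extensionality, H.
Qed.

Lemma mean_mono (A B : G -> Prop) : (forall x, A x -> B x) -> m A <= m B.
Proof.
  intros H. rewrite (mean_ext B (fun x => A x \/ (B x /\ ~ A x))).
  - rewrite m_add by tauto. pose proof (m_ge0 (fun x => B x /\ ~ A x)). lra.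
  - intros x. specialize (H x). tauto.
Qed.

(** An injective piecewise translation preserves the mean: by induction on [T], split off the piece
    [A1] on which [f] translates by [t]. Its image is [t ** A1], disjoint from the image of the
    rest. *)
Lemma mean_image (f : G -> G) (T : list G) : forall A : G -> Prop,
  (forall x y, A x -> A y -> f x = f y -> x = y) ->
  (forall x, A x -> exists t, In t T /\ f x = t ** x) ->
  m (fun y => exists x, A x /\ y = f x) = m A.
Proof.
  induction T as [|t T IH]; intros A Hinj HT.
  - apply mean_ext. intros y. split.
    + intros (x & Hx & _). destruct (HT x Hx) as (? & [] & _).
    + intros Hy. destruct (HT y Hy) as (? & [] & _).
  - set (A1 := fun x => A x /\ f x = t ** x). set (A2 := fun x => A x /\ f x <> t ** x).
    rewrite (mean_ext A (fun x => A1 x \/ A2 x)).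
    2: { intros x. unfold A1, A2. destruct (classic (f x = t ** x)); tauto. }
    rewrite (mean_ext (fun y => exists x, A x /\ y = f x)
       (fun y => A1 (t^- ** y) \/ exists x, A2 x /\ y = f x)).
    + rewrite (m_add A1 A2) by (intros x [_ H] [_ H0]; contradiction).
      rewrite m_add, m_inv, IH; auto.
      * intros x y [Hx _] [Hy _]; auto.
      * intros x [Hx Hn]. destruct (HT x Hx) as (u & [->|Hu] & E); [contradiction|eauto].
      * intros y [H1 H2] (x & [Hx Hn] & ->). apply Hn.
        rewrite gmul_KV in H2. apply Hinj in H2; auto. now rewrite <- H2 at 2; rewrite gmul_KV.
    + intros y. split.
      * intros (x & Hx & ->). destruct (classic (f x = t ** x)) as [E|E].
        -- left. rewrite E, gmul_VK. now split.
        -- right. exists x. repeat split; auto.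
      * intros [[H1 H2]|(x & [Hx _] & ->)]; [|eauto].
        exists (t^- ** y). rewrite H2, gmul_KV. auto.
Qed.

(** The two copies of [G] have disjoint images in [G], each with the mean of the whole group, so
    twice that mean is at most itself. *)
Lemma mean_not_paradoxical (f : G * bool -> G) (T : list G) :
  (forall p q, f p = f q -> p = q) ->
  (forall p, exists t, In t T /\ f p = t ** fst p) ->
  m (fun _ => True) = 0.
Proof.
  intros Hinj HT.
  assert (E : forall b, m (fun y => exists x, True /\ y = f (x, b)) = m (fun _ => True)).
  { intros b. apply (mean_image (fun x => f (x, b)) T).
    - intros x y _ _ H. apply Hinj in H. congruence.
    - intros x _. apply (HT (x, b)). }
  assert (H : m (fun y => (exists x, True /\ y = f (x, true)) \/
                          (exists x, True /\ y = f (x, false))) <= m (fun _ => True)).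
  { now apply mean_mono. }
  rewrite m_add, !E in H.
  - pose proof (m_ge0 (fun _ => True)). lra.
  - intros y (x & _ & ->) (x' & _ & Hx). apply Hinj in Hx. congruence.
Qed.

End Mean.

Lemma card_fatten_iter S eps : 0 < eps ->
  (forall F, (1 + eps) * INR (card F) <= INR (card (fatten G S F))) ->
  forall n F, (1 + eps) ^ n * INR (card F) <= INR (card (Nat.iter n (fatten G S) F)).
Proof.
  intros He H n F. induction n as [|n IH]; simpl; [lra|].
  eapply Rle_trans; [|apply H]. rewrite Rmult_assoc.
  apply Rmult_le_compat_l; lra.
Qed.

Lemma iter_fatten_balls S n F :
  incl (Nat.iter n (fatten G S) F) (flat_map (fun x => map (fun t => t ** x) (ball G S n)) F).
Proof.
  induction n as [|n IH]; intros y; simpl.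
  - intros Hy. apply in_flat_map. exists y. split; auto. left. apply gmul_1l.
  - rewrite in_fatten, in_flat_map. intros [Hy|(x & s & Hx & Hs & ->)].
    + apply IH, in_flat_map in Hy as (z & Hz & Hy). exists z. split; auto.
      rewrite <- fatten_translate. apply in_fatten. now left.
    + apply IH, in_flat_map in Hx as (z & Hz & Hy). exists z. split; auto.
      rewrite <- fatten_translate. apply in_fatten. right; eauto.
Qed.

(* Folner sets. If they did not exist, a large ball would at least double every finite set,
   and Hall's theorem would give a paradoxical decomposition. *)
Lemma amenable_folner S : amenable G -> (forall x, generated G S x) ->
  forall eps, 0 < eps -> exists F, NoDup F /\
    INR (card (fatten G S F)) < (1 + eps) * INR (card F).
Proof.
  intros (m & m0 & m1 & madd & minv) HS eps Heps. apply NNPP. intros Hn.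
  assert (H : forall F, (1 + eps) * INR (card F) <= INR (card (fatten G S F))).
  { intros F. apply Rnot_lt_le. intros HF. apply Hn.
    exists (nodup (classical_eq_dec G) F). split; [apply NoDup_nodup|].
    rewrite card_nodup. eapply Rle_lt_trans; [|exact HF]. apply le_INR, card_le.
    intros y. rewrite !in_fatten. setoid_rewrite nodup_In. auto. }
  destruct (pow_unbounded eps 2 Heps) as [n Hpow].
  (* Both copies of an element are joined to the ball of radius [n] around it; an injective matching
     of this relation is a paradoxical decomposition. *)
  set (N := fun p : G * bool => map (fun t => t ** fst p) (ball G S n)).
  (* The size of [A] is at most twice that of its projection to [G], and [n] fattenings at least
     double the projection. *)
  assert (HN : hall N).
  { intros A ND. set (B := nodup (classical_eq_dec G) (map fst A)).
    assert (L1 : (length A <= length B * 2)%nat).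
    { change 2%nat with (length [true; false]). rewrite <- length_prod.
      apply NoDup_incl_length; auto. intros [x b] Hx. apply in_prod.
      - apply nodup_In. change x with (fst (x, b)). now apply in_map.
      - destruct b; simpl; auto. }
    assert (L2 : (length B * 2 <= card (Nat.iter n (fatten G S) (map fst A)))%nat).
    { apply INR_le. rewrite mult_INR. change (length B) with (card (map fst A)).
      eapply Rle_trans; [|apply card_fatten_iter; eauto].
      pose proof (pos_INR (card (map fst A))). simpl INR. nra. }
    assert (L3 : (card (Nat.iter n (fatten G S) (map fst A)) <= card (flat_map N A))%nat); [|lia].
    apply card_le. intros y Hy. apply iter_fatten_balls, in_flat_map in Hy as (x & Hx & Hy).
    apply in_map_iff in Hx as (p & <- & Hp). apply in_flat_map. eauto. }
  destruct (hall_matching N (fun k => list_prod (ball G S k) [true; false]) HN) as (f & Hf & Hinj).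
  { intros [x b]. destruct (generated_ball G S x (HS x)) as [k Hk]. exists k.
    apply in_prod; auto. destruct b; simpl; auto. }
  enough (m (fun _ => True) = 0) by lra.
  apply (mean_not_paradoxical m m0 madd minv f (ball G S n)); auto.
  intros p. specialize (Hf p). apply in_map_iff in Hf as (t & E & Ht). eauto.
Qed.

(* Summing the weight of [F ** h] over all translates [h] counts every vertex [card F] times, so
   a Folner set has a translate that is isoperimetric for the given weight. *)
Lemma folner_isoperimetric S eps F : 0 < eps -> NoDup F ->
  INR (card (fatten G S F)) < (1 + eps) * INR (card F) ->
  symmetric_set G S ->
  weighted_isoperimetric (cayley_adj G S) eps (length F).
Proof.
  intros He NF HF HS L w NL Hw HL.
  (* The finitely many [h] for which [F ** h] meets [L]. *)
  set (H := nodup (classical_eq_dec G) (flat_map (fun y => map (fun f => f^- ** y) F) L)).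
  set (tr := fun (F : list G) h y => In (y ** h^-) F).
  assert (Hsum : forall F', wsum (fun h => wsum w (sieve (tr F' h) L)) H =
     wsum (fun y => w y * INR (length (sieve (fun h => tr F' h y) H))) L).
  { intros F'. rewrite (wsum_ext _ (fun h => wsum (fun y => w y * indicator (tr F' h) y) L)).
    2: { intros h _. apply wsum_sieve. }
    rewrite wsum_swap. apply wsum_ext. intros y _.
    rewrite <- wsum_indicator, <- wsum_scal. reflexivity. }
  (* For fixed [y], the element [y ** h^-] of [F'] determines [h]. The opposite bound for [F] holds
     because [H] contains every [f^- ** y] with [y] in [L]. *)
  assert (Hup : forall F' y, (length (sieve (fun h => tr F' h y) H) <= card F')%nat).
  { intros F' y. rewrite <- (length_map (fun h => y ** h^-)), <- card_NoDup.
    - apply card_le. intros z Hz. apply in_map_iff in Hz as (h & <- & Hh).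
      now apply in_sieve in Hh.
    - apply NoDup_map_NoDup_ForallPairs; [|apply NoDup_sieve, NoDup_nodup].
      intros h h' _ _ E. apply ginv_inj. now rewrite <- (gmul_VK G y (h^-)), E, gmul_VK. }
  assert (Hlow : forall y, In y L -> (length F <= length (sieve (fun h => tr F h y) H))%nat).
  { intros y Hy. rewrite <- (length_map (fun f => f^- ** y) F). apply NoDup_incl_length.
    - apply NoDup_map_NoDup_ForallPairs; auto. intros f f' _ _ E.
      apply ginv_inj. now rewrite <- (gmul_rK G (f^-) y), E, gmul_rK.
    - intros h Hh. apply in_sieve. split.
      + apply nodup_In, in_flat_map. eauto.
      + apply in_map_iff in Hh as (f & <- & Hf). unfold tr.
        rewrite ginv_mul, ginv_inv, gmul_assoc, gmul_Vr, gmul_1l. exact Hf. }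
  set (F' := fatten G S F) in *.
  assert (Hpos : 0 < wsum (fun h => (1 + eps) * wsum w (sieve (tr F h) L)
                                    + (- 1) * wsum w (sieve (tr F' h) L)) H).
  { rewrite wsum_add, !wsum_scal, !Hsum.
    assert (B1 : INR (card F) * wsum w L <=
                 wsum (fun y => w y * INR (length (sieve (fun h => tr F h y) H))) L).
    { rewrite <- wsum_scal. apply wsum_le. intros y Hy. rewrite card_NoDup by auto.
      specialize (Hw y Hy). pose proof (le_INR _ _ (Hlow y Hy)). nra. }
    assert (B2 : wsum (fun y => w y * INR (length (sieve (fun h => tr F' h y) H))) L
                 <= INR (card F') * wsum w L).
    { rewrite <- wsum_scal. apply wsum_le. intros y Hy.
      specialize (Hw y Hy). pose proof (le_INR _ _ (Hup F' y)). nra. }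
    nra. }
  apply wsum_pos_ex in Hpos as (h & _ & Hh).
  assert (0 <= wsum w (sieve (tr F' h) L)).
  { apply wsum_ge0. intros x Hx. apply in_sieve in Hx. apply Hw; tauto. }
  exists (tr F h), (tr F' h). repeat split.
  - intros x Hx. apply in_fatten. now left.
  - intros x y Hx Hxy. apply cayley_adj_sym in Hxy as (s & Hs & ->); auto.
    apply in_fatten. right. exists (x ** h^-), s. repeat split; auto.
    symmetry; apply gmul_assoc.
  (* The whole piece lies in a translate of [F], which already bounds its components. *)
  - intros x c _ ND Hc. rewrite <- (length_map (fun y => y ** h^-)). apply NoDup_incl_length.
    + apply NoDup_map_NoDup_ForallPairs; auto. intros y y' _ _ E.
      now rewrite <- (gmul_rVK G y h), E, gmul_rVK.
    + intros z Hz. apply in_map_iff in Hz as (y & <- & Hy).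
      apply Hc, conn_in_right in Hy. apply Hy.
  - lra.
  - nra.
Qed.

End Amenable.

(** * Isoperimetry from finite asymptotic dimension *)

Section AsymptoticDimension.
Context (G : Group).

Lemma generated_walk S x : generated G S x ->
  exists k, forall y, walk (cayley_adj G S) k (gmul G x y) y.
Proof.
  induction 1 as [|s x Hs _ [k IH]].
  - exists 0%nat. intros y. rewrite gmul_1l. constructor.
  - exists (1 + k)%nat. intros y. apply walk_cat with (gmul G x y); auto.
    apply walkS with (gmul G (gmul G s x) y); [constructor|].
    exists s. split; auto. symmetry; apply gmul_assoc.
Qed.

(** Each of the finitely many elements of [S] is a word in [S']; [c] is the sum of the word lengths.
    This transfers the cover given for [S'] to the graph of [S]. *)
Lemma cayley_adj_dist S S' : (forall x, generated G S' x) ->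
  exists c, forall x y, cayley_adj G S x y -> dist_le (cayley_adj G S') c x y.
Proof.
  intros HS'. induction S as [|s S [c IH]].
  - exists 0%nat. intros x y (s & [] & _).
  - destruct (generated_walk S' s (HS' s)) as [k Hk].
    exists (k + c)%nat. intros x y (u & [<-|Hu] & ->).
    + exists k. split; [lia|auto].
    + destruct (IH (gmul G u y) y) as (j & Hj & W).
      * now exists u.
      * exists j. split; [lia|auto].
Qed.

Lemma walk_dist S S' c :
  (forall x y, cayley_adj G S x y -> dist_le (cayley_adj G S') c x y) ->
  forall n x y, walk (cayley_adj G S) n x y -> dist_le (cayley_adj G S') (n * c) x y.
Proof.
  intros Hc n x y W. induction W as [x|n x y z W (j & Hj & Wj) A].
  - exists 0%nat. split; [lia|constructor].
  - destruct (Hc _ _ A) as (k & Hk & Wk). exists (j + k)%nat. split; [lia|].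
    now apply walk_cat with y.
Qed.

(** Pigeonhole: the weights of the [d] classes add up to at least that of [L]. *)
Lemma wsum_cover (L : list G) (w : G -> R) (U : nat -> G -> Prop) (d : nat) :
  (forall x, In x L -> 0 <= w x) ->
  (forall x, In x L -> exists i, (i < d)%nat /\ U i x) ->
  0 < wsum w L ->
  exists i, (i < d)%nat /\ wsum w L <= INR d * wsum w (sieve (U i) L).
Proof.
  intros Hw HU HL. apply NNPP. intros Hn.
  assert (Hlt : forall i, (i < d)%nat -> INR d * wsum w (sieve (U i) L) < wsum w L).
  { intros i Hi. apply Rnot_le_lt. eauto. }
  assert (A1 : wsum w L <= wsum (fun i => wsum w (sieve (U i) L)) (seq 0 d)).
  { rewrite (wsum_ext (fun i => wsum w (sieve (U i) L))
      (fun i => wsum (fun x => w x * indicator (U i) x) L))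
      by (intros; apply wsum_sieve).
    rewrite wsum_swap. apply wsum_le. intros x Hx.
    rewrite (wsum_scal (w x) (fun i => indicator (U i) x)).
    destruct (HU x Hx) as (i & Hi & Ui).
    rewrite (wsum_indicator (fun i => U i x)).
    assert (1 <= length (sieve (fun i => U i x) (seq 0 d)))%nat.
    { assert (In i (sieve (fun i => U i x) (seq 0 d))).
      { apply in_sieve. split; auto. apply in_seq. lia. }
      destruct (sieve (fun i => U i x) (seq 0 d)); simpl in *; [easy|lia]. }
    apply le_INR in H. simpl INR in H at 1. specialize (Hw x Hx). nra. }
  assert (Hd : 0 < INR d).
  { destruct d; [simpl in A1; lra|]. apply lt_0_INR; lia. }
  set (q := wsum w L) in *.
  (* Summing the strict inequalities stays strict only over a nonempty list. *)
  assert (A2 : forall l, incl l (seq 0 d) -> l <> [] ->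
     INR d * wsum (fun i => wsum w (sieve (U i) L)) l < INR (length l) * q).
  { induction l as [|i l IH]; intros Hl Hne; [easy|].
    assert (Hi : (i < d)%nat) by (specialize (Hl i (or_introl eq_refl)); apply in_seq in Hl; lia).
    specialize (Hlt i Hi). cbn [wsum fold_right length]. rewrite S_INR.
    fold (wsum (fun i => wsum w (sieve (U i) L)) l).
    destruct l as [|j l]; [simpl in *; nra|].
    assert (IH' : INR d * wsum (fun i => wsum w (sieve (U i) L)) (j :: l) < INR (length (j :: l)) * q).
    { apply IH; [|easy]. intros z Hz. apply Hl. now right. }
    lra. }
  specialize (A2 (seq 0 d) (incl_refl _)). rewrite length_seq in A2.
  assert (seq 0 d <> []) by (destruct d; [simpl in Hd; lra|easy]).
  specialize (A2 H). nra.
Qed.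

(** Otherwise every step multiplies by more than [1 + eps], and [a n] exceeds [b * a 0]. *)
Lemma slow_growth_step (a : nat -> R) (eps b : R) (n : nat) :
  0 < eps -> b <= (1 + eps) ^ n -> 0 < a 0%nat -> a n <= b * a 0%nat ->
  (forall k, a k <= a (S k)) -> (0 < n)%nat ->
  exists k, (k < n)%nat /\ a (S k) <= (1 + eps) * a k.
Proof.
  intros He Hb Ha Hn Hmon Hn0. apply NNPP. intros H.
  assert (Hlt : forall k, (k < n)%nat -> (1 + eps) * a k < a (S k)).
  { intros k Hk. apply Rnot_le_lt. eauto. }
  assert (Hg : forall k, (k < n)%nat -> (1 + eps) ^ S k * a 0%nat < a (S k)).
  { induction k as [|k IH]; intros Hk.
    - rewrite pow_1. now apply Hlt.
    - specialize (IH (Nat.lt_succ_l _ _ Hk)). specialize (Hlt _ Hk).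
      change ((1 + eps) ^ S (S k)) with ((1 + eps) * (1 + eps) ^ S k). nra. }
  destruct n as [|n]; [lia|]. specialize (Hg n (Nat.lt_succ_diag_r n)). nra.
Qed.

Definition neighbourhood (S : list G) (U : G -> Prop) (k : nat) (x : G) : Prop :=
  exists u, U u /\ dist_le (cayley_adj G S) k x u.

(** Each vertex of a path in [P] has a point of [U] within distance [k]. The points for consecutive
    vertices are at distance at most [k + 1 + k], so all of them lie in one component of [U]. *)
Lemma neighbourhood_conn S S' U k (P : G -> Prop) :
  symmetric_set G S ->
  (forall u v, U u -> U v -> dist_le (cayley_adj G S) (k + 1 + k) u v ->
     conn_in (cayley_adj G S') U u v) ->
  (forall x, P x -> neighbourhood S U k x) ->
  forall x y u, conn_in (cayley_adj G S) P x y -> U u -> dist_le (cayley_adj G S) k x u ->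
    exists v, conn_in (cayley_adj G S') U u v /\ dist_le (cayley_adj G S) k y v.
Proof.
  intros HS HU HP x y u C Uu Hu. induction C as [x Px | x y z C IH Pz A].
  - exists u. split; auto. now constructor.
  - destruct (IH Hu) as (v & Cv & j & Hj & Wj).
    destruct (HP z Pz) as (v' & Uv' & j' & Hj' & Wj').
    exists v'. split; [|now exists j'].
    apply conn_in_trans with v; auto. apply HU; auto; [now apply conn_in_right in Cv|].
    exists (j + 1 + j')%nat. split; [lia|].
    apply walk_cat with z; auto. apply walk_cat with y.
    + apply walk_rev; auto. now apply cayley_adj_sym.
    + apply walkS with y; auto. constructor.
Qed.

Lemma dist_le_mono S m n x y : (m <= n)%nat ->
  dist_le (cayley_adj G S) m x y -> dist_le (cayley_adj G S) n x y.
Proof. intros H (k & Hk & W). exists k. split; [lia|auto]. Qed.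

Lemma asdim_isoperimetric S S' d eps :
  symmetric_set G S -> finite_symmetric_generating_set G S' ->
  asdim_le (cayley_adj G S') d -> 0 < eps ->
  exists K, weighted_isoperimetric (cayley_adj G S) eps K.
Proof.
  intros HS [HS' Hgen] Hd He.
  destruct (cayley_adj_dist S S' Hgen) as [c Hc].
  destruct (pow_unbounded eps (INR d) He) as [n0 Hn0].
  (* The successor keeps [n] positive, so that there is a step to choose. *)
  set (n := Datatypes.S n0).
  assert (Hn : INR d <= (1 + eps) ^ n) by (simpl; pose proof (pow_lt (1 + eps) n0); nra).
  (* Points of a class at [S]-distance at most [n + 1 + n] have [S']-distance below this scale,
     hence share a component. *)
  destruct (Hd (Datatypes.S ((n + 1 + n) * c))) as (Rr & U & Hcov & _ & HU); [lia|].
  (* A vertex of a component of the piece is [t ** v], with [t] in the [S]-ball of radius [n] and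
     [v] in the [S']-ball of radius [Rr] around a fixed [u]. *)
  exists (length (ball G S n) * length (ball G S' Rr))%nat.
  intros L w ND Hw HL.
  destruct (wsum_cover L w U d Hw) as (i & Hi & HLi); auto.
  destruct (HU i Hi) as [Hdiam Hsep].
  set (E := neighbourhood S (U i)).
  assert (Emono : forall k k' x, (k <= k')%nat -> E k x -> E k' x).
  { intros k k' x Hk (u & Hu & D). exists u. split; auto. now apply dist_le_mono with k. }
  assert (HE0 : wsum w (sieve (U i) L) <= wsum w (sieve (E 0%nat) L)).
  { apply wsum_sieve_mono; auto. intros x _ Ux. exists x. split; auto.
    exists 0%nat. split; [lia|constructor]. }
  assert (HEn : wsum w (sieve (E n) L) <= wsum w L).
  { rewrite (wsum_sieve_split (E n) w L).
    pose proof (wsum_ge0 w (sieve (fun x => ~ E n x) L)) as H.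
    enough (0 <= wsum w (sieve (fun x => ~ E n x) L)) by lra. apply H.
    intros x Hx. apply in_sieve in Hx. apply Hw; tauto. }
  pose proof (pos_INR d) as Hdpos.
  assert (H0 : 0 < wsum w (sieve (U i) L)) by nra.
  (* The weight of [E n] is at most that of [L], thus at most [d] times that of [E 0]. *)
  destruct (slow_growth_step (fun k => wsum w (sieve (E k) L)) eps (INR d) n)
    as (k & Hk & Hgrow); auto.
  - lra.
  - nra.
  - intros j. apply wsum_sieve_mono; auto. intros x _. apply Emono. lia.
  - unfold n; lia.
  - exists (E k), (E (Datatypes.S k)). repeat split; auto.
    + intros x. apply Emono. lia.
    + intros x y (u & Uu & j & Hj & W) A. exists u. split; auto.
      exists (1 + j)%nat. split; [lia|]. apply walk_cat with x; auto.
      apply walkS with y; [constructor|]. now apply cayley_adj_sym.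
    + intros x l [_ (u & Uu & Du)] NDl Hl.
      rewrite <- (length_map (fun t => gmul G t u) (ball G S' Rr)), Nat.mul_comm.
      rewrite <- length_prod.
      rewrite <- (length_map (fun p => gmul G (snd p) (fst p))).
      apply NoDup_incl_length; auto. intros y Hy.
      destruct (neighbourhood_conn S S' (U i) k (fun x => In x L /\ E k x)) with x y u
        as (v & Cv & Dv); auto.
      { intros a b Ua Ub (j & Hj & W). apply NNPP. intros Nab. apply (Hsep a b Ua Ub Nab).
        destruct (walk_dist S S' c Hc _ _ _ W) as (j' & Hj' & W'). exists j'. split; auto.
        apply Nat.lt_succ_r. etransitivity; [exact Hj'|]. apply Nat.mul_le_mono_r. lia. }
      { tauto. }
      apply Hdiam, dist_le_ball in Cv; auto.
      apply dist_le_mono with (n := n) in Dv; [|lia].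
      destruct Dv as (j & Hj & W).
      apply walk_rev in W; [|now apply cayley_adj_sym].
      assert (D : In y (map (fun t => gmul G t v) (ball G S n))).
      { apply dist_le_ball; auto. now exists j. }
      apply in_map_iff in D as (t & <- & Ht).
      apply in_map_iff. exists (v, t). split; auto. now apply in_prod.
    + enough (wsum w (sieve (E 0%nat) L) <= wsum w (sieve (E k) L)) by lra.
      apply wsum_sieve_mono; auto. intros x _. apply Emono. lia.
Qed.

End AsymptoticDimension.

Theorem theorem1p2 (G : Group) :
  finitely_generated G -> (amenable G \/ finite_asdim G) ->
  forall S : list G, finite_symmetric_generating_set G S ->
    weighted_hyperfinite (cayley_adj G S).
Proof.
  intros _ H S [HS Hgen].
  apply isoperimetric_weighted_hyperfinite; [now apply cayley_adj_sym|].
  intros eps He. destruct H as [Ha | (S' & HS' & d & Hd)].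
  - destruct (amenable_folner G S Ha Hgen eps He) as (F & NF & HF).
    exists (length F). now apply folner_isoperimetric.
  - now apply asdim_isoperimetric with S' d.
Qed.
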